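(* Let $V$ be a finite ground set, $Y$ a finite state set, $p$ a prior over $\Phi_V$, and $f:2^V\times\Phi_V\to\mathbb{R}$ a non-negative utility function that is adaptive monotone with respect to $p$. Let $\pi$ be a policy of height $n$ such that $\pi=\pi'_l$ for some policy $\pi'$ and some integer $l\le c_{\mathrm{avg}}(\pi',p)$; that is, $\pi$ is the (unique) threshold/tie-break sub-policy of $\pi'$ with average cost $c_{\mathrm{avg}}(\pi,p)=l$ (informally: $\pi$ terminates when the expected marginal gain of all remaining elements is below some fixed threshold, and has average cost $l$). Let $\pi^*$ be any policy of height $k$. Then \[ f_{\mathrm{avg}}(\pi, p) \geq \left(1 - \exp\left(-l\bigg/\bigg(\frac{\beta_\pi(f,p)}{\gamma^s_{n,k}(f,p)}\cdot c_{\mathrm{avg}}(\pi^*, p)+1\bigg)\right)\right) \cdot f_{\mathrm{avg}}(\pi^*, p). \]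
   Context: Setting: a realization is a map $\phi:V\to Y$; $\Phi_V$ is the set of realizations. A partial realization $\psi$ is a map from a subset $\mathrm{dom}(\psi)\subseteq V$ to $Y$; $\Psi_V$ is the set of partial realizations; $\phi\sim\psi$ means $\phi$ agrees with $\psi$ on $\mathrm{dom}(\psi)$; $\psi\subseteq\psi'$ means $\psi'$ extends $\psi$; $|\psi|=|\mathrm{dom}(\psi)|$. The true realization $\phi$ is drawn from the prior $p$. A policy $\pi:\Psi_V\to V\cup\{\bot\}$ (possibly randomized) selects elements sequentially, observing each selected element's state; after observing $\psi_t$ (the states of the first $t$ selected elements) it selects $\pi(\psi_t)$, or terminates if $\pi(\psi_t)=\bot$. $E(\pi,\phi)$ is the (random) set of elements selected until termination under $\phi$. The height of $\pi$ is the maximum number of elements it may select over all realizations and random bits; $\Pi_k$ is the set of policies of height at most $k$. A sub-policy of $\pi$ runs exactly like $\pi$ but may terminate earlier. $f_{\mathrm{avg}}(\pi,p)=\mathbb{E}[f(E(\pi,\phi),\phi)]$ and $c_{\mathrm{avg}}(\pi,p)=\mathbb{E}[|E(\pi,\phi)|]$, with expectation over $\phi\sim p$ and the policy's randomness. Marginal gains: $\Delta^f_p(v\mid\psi)=\mathbb{E}[f(\{v\}\cup\mathrm{dom}(\psi),\phi)-f(\mathrm{dom}(\psi),\phi)\mid\phi\sim\psi]$ and $\Delta^f_p(\pi\mid\psi)=\mathbb{E}[f(E(\pi,\phi)\cup\mathrm{dom}(\psi),\phi)-f(\mathrm{dom}(\psi),\phi)\mid\phi\sim\psi]$. $f$ is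 adaptive monotone w.r.t. $p$ if $\Delta^f_p(v\mid\psi)\ge 0$ for all $\psi$ and $v\notin\mathrm{dom}(\psi)$. The adaptive submodularity ratio is \[\gamma^s_{n,k}(f,p)=\min_{\psi\in\Psi_V:|\psi|\le n,\ \psi'\subseteq\psi,\ \pi\in\Pi_k}\frac{\sum_{v\in V}\Pr_{\Phi\sim p}[v\in E(\pi,\Phi)\mid\Phi\sim\psi']\,\Delta^f_p(v\mid\psi')}{\Delta^f_p(\pi\mid\psi')}.\] Threshold sub-policies: for $\tau\ge0$, $\rho\in[0,1]$, $\pi^{\tau,\rho}$ is the sub-policy of $\pi$ that, with probability $\rho$, terminates as soon as every remaining element has expected marginal gain strictly smaller than $\tau$, and otherwise (probability $1-\rho$) terminates as soon as every remaining element has expected marginal gain at most $\tau$. For each integer $i\le c_{\mathrm{avg}}(\pi,p)$ there are $\tau_i,\rho_i$ with $c_{\mathrm{avg}}(\pi^{\tau_i,\rho_i},p)=i$, and all such pairs give the same policy, denoted $\pi_i$; $\pi_0$ terminates before selecting anything. $\Delta^u_{\pi,i}$ is the smallest $u$ such that almost surely, when $\pi_i$ terminates at time $t$, $\Delta^f_p(v\mid\psi_t)\le u$ for all $v\in V$. $\Delta^l_{\pi,i}$ is the largest $u$ such that almost surely, for all times $t$ before $\pi_i$ terminates, $\Delta^f_p(\pi_i(\psi_t)\mid\psi_t)\ge u$. The maximal gain ratio is $\beta_\pi(f,p)=\max_{i\in\mathbb{N},\,i\le c_{\mathrm{avg}}(\pi,p)}\Delta^u_{\pi,i}/\Delta^l_{\pi,i}$.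 *)

(* Defs.v *)
From HB Require Import structures.
From mathcomp Require Import all_boot all_order all_algebra.
From mathcomp Require Import all_classical all_reals all_analysis.

Set Implicit Arguments.
Unset Strict Implicit.
Unset Printing Implicit Defensive.

Import Order.TTheory GRing.Theory Num.Theory.
Local Open Scope ring_scope.
Local Open Scope classical_set_scope.

Definition Phi (V Y : finType) := {ffun V -> Y}.
Definition Psi (V Y : finType) := {ffun V -> option Y}.
(* A deterministic policy maps the observed partial realization to the     *)
(* next element to select (Some v) or to termination (None = bottom).      *)
Definition dpol (V Y : finType) := {ffun Psi V Y -> option V}.

Section Adaptive.
Context {V Y : finType} {R : realType}.

Definition dom (psi : Psi V Y) : {set V} := [set v | psi v != None].

Definition consistent (phi : Phi V Y) (psi : Psi V Y) : bool :=
  [forall v, if psi v is Some y then phi v == y else true].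

Definition subreal (psi' psi : Psi V Y) : Prop :=
  forall v y, psi' v = Some y -> psi v = Some y.

Definition empty_real : Psi V Y := [ffun _ => None].

Definition valid (s : dpol V Y) : Prop :=
  forall psi v, s psi = Some v -> psi v = None.

Definition step (s : dpol V Y) (phi : Phi V Y) (psi : Psi V Y) : Psi V Y :=
  match s psi with
  | Some v => [ffun u => if u == v then Some (phi v) else psi u]
  | None => psi
  end.

Definition run (s : dpol V Y) (phi : Phi V Y) (t : nat) : Psi V Y :=
  iter t (step s phi) empty_real.

(* observations at termination (a valid policy stops after <= |V| steps) *)
Definition final (s : dpol V Y) (phi : Phi V Y) : Psi V Y := run s phi #|V|.

Definition Esel (s : dpol V Y) (phi : Phi V Y) : {set V} := dom (final s phi).

(* Prior and (randomized) policies = probability distributions over         *)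
(* deterministic valid policies (the random bits select the deterministic   *)
(* policy that is run).                                                     *)
Definition is_prior (p : Phi V Y -> R) : Prop :=
  (forall phi, 0 <= p phi) /\ \sum_phi p phi = 1.

Definition is_policy (w : dpol V Y -> R) : Prop :=
  [/\ forall s, 0 <= w s, \sum_s w s = 1 & forall s, 0 < w s -> valid s].

Definition height (w : dpol V Y -> R) : nat :=
  \max_(s | 0 < w s) \max_(phi : Phi V Y) #|Esel s phi|.

Variable p : Phi V Y -> R.
Variable f : {set V} -> Phi V Y -> R.

Definition PrC (psi : Psi V Y) : R :=
  \sum_(phi | consistent phi psi) p phi.

(* Delta^f_p(v | psi)  (conditional expectation; := 0 if Pr[phi ~ psi] = 0) *)
Definition Delta (v : V) (psi : Psi V Y) : R :=
  (\sum_(phi | consistent phi psi)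
      p phi * (f (v |: dom psi) phi - f (dom psi) phi)) / PrC psi.

Definition DeltaPol (w : dpol V Y -> R) (psi : Psi V Y) : R :=
  (\sum_s w s * \sum_(phi | consistent phi psi)
      p phi * (f (Esel s phi :|: dom psi) phi - f (dom psi) phi)) / PrC psi.

Definition PrSel (w : dpol V Y -> R) (v : V) (psi : Psi V Y) : R :=
  (\sum_s w s * \sum_(phi | consistent phi psi && (v \in Esel s phi)) p phi)
    / PrC psi.

Definition adaptive_monotone : Prop :=
  forall (psi : Psi V Y) v, v \notin dom psi -> 0 <= Delta v psi.

Definition f_avg (w : dpol V Y -> R) : R :=
  \sum_s w s * \sum_phi p phi * f (Esel s phi) phi.

Definition c_avg (w : dpol V Y -> R) : R :=
  \sum_s w s * \sum_phi p phi * (#|Esel s phi|)%:R.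

Definition trunc (s : dpol V Y) (tau : R) (strict : bool) : dpol V Y :=
  [ffun psi => if [forall v in ~: dom psi,
                     if strict then Delta v psi < tau else Delta v psi <= tau]
               then None else s psi].

Definition tsub (w : dpol V Y -> R) (tau rho : R) : dpol V Y -> R :=
  fun s' => \sum_s w s * (rho * (trunc s tau true == s')%:R
                          + (1 - rho) * (trunc s tau false == s')%:R).

Definition pol_i (w : dpol V Y -> R) (i : nat) : set (dpol V Y -> R) :=
  [set w' | exists tau rho : R, [/\ 0 <= tau, 0 <= rho <= 1,
      w' = tsub w tau rho & c_avg (tsub w tau rho) = i%:R]].

Definition Delta_u (w : dpol V Y -> R) : \bar R :=
  ereal_inf [set u%:E | u in [set u : R | forall s phi, 0 < w s -> 0 < p phi ->
      forall v, Delta v (final s phi) <= u]].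

(* Delta^l of a policy: largest u such that a.s., at every time t before  *)
(* termination, Delta(pi(psi_t) | psi_t) >= u  (+oo if nothing is ever     *)
(* selected).                                                              *)
Definition Delta_l (w : dpol V Y -> R) : \bar R :=
  ereal_sup [set u%:E | u in [set u : R | forall s phi, 0 < w s -> 0 < p phi ->
      forall t v, (t < #|Esel s phi|)%N -> s (run s phi t) = Some v ->
        u <= Delta v (run s phi t)]].

(* ratio a / b in the extended reals: a / +oo = 0; a / b = +oo if b <= 0    *)
(* (undefined ratio, excluded by the finiteness hypothesis on beta).       *)
Definition eratio (a b : \bar R) : \bar R :=
  match b with
  | +oo%E => 0%E
  | EFin r => if 0 < r then (a * (r^-1)%:E)%E else +oo%E
  | -oo%E => +oo%E
  end.

Definition beta_ratio (w : dpol V Y -> R) : \bar R :=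
  ereal_sup [set eratio (Delta_u w') (Delta_l w') | w' in
     [set w' | exists i : nat, i%:R <= c_avg w /\ pol_i w i w']].

(* adaptive submodularity ratio gamma^s_{n,k}(f, p); ratios with zero      *)
(* denominator Delta(pi | psi') = 0 are excluded (0/0 convention).         *)
Definition gamma_s (n k : nat) : \bar R :=
  ereal_inf [set r | exists (psi psi' : Psi V Y) (w : dpol V Y -> R),
     [/\ (#|dom psi| <= n)%N /\ subreal psi' psi, is_policy w,
         (height w <= k)%N, 0 < DeltaPol w psi' &
         r = ((\sum_v PrSel w v psi' * Delta v psi') / DeltaPol w psi')%:E]].
End Adaptive.

(* Main.v *)
(* Write pi_i for the threshold sub-policy of pi of average cost i, U_i for the
   largest gain left when pi_i stops, L_i for the smallest gain of an element it
   selects, F_i for its average utility and F for that of pistar.  Running pistar after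
   pi_i gives, by adaptive monotonicity and the definition of gamma,
   F <= F_i + (U_i / gamma) * c_avg(pistar) <= F_i + B * L_i with
   B = (beta / gamma) * c_avg(pistar).  Since pi_(i-1) is a truncation of pi_i and
   costs one less, L_i <= F_i - F_(i-1).  Together,
   F - F_i <= (B / (B + 1)) * (F - F_(i-1)), and B / (B + 1) <= exp (- 1 / (B + 1)).
   The policies pi_i exist because the cost is a step function of the threshold
   whose jumps are interpolated by the tie-breaking probability. *)
From HB Require Import structures.
Require Import Defs.
From mathcomp Require Import all_boot all_order all_algebra.
From mathcomp Require Import all_classical all_reals all_analysis.
From mathcomp Require Import ring lra.
Import Order.TTheory GRing.Theory Num.Theory.
Local Open Scope ring_scope.

(** * Partial realizations and runs of deterministic policies *)

Section PartialRealizations.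
Context {V Y : finType}.
Implicit Types (s : dpol V Y) (phi : Phi V Y) (psi : Psi V Y).

Lemma in_dom psi v : (v \in dom psi) = (psi v != None).
Proof. by rewrite inE. Qed.

Lemma consistentP phi psi :
  reflect (forall v y, psi v = Some y -> phi v = y) (consistent phi psi).
Proof.
apply: (iffP forallP) => [h v y e|h v]; first by have := h v; rewrite e => /eqP.
by case e : (psi v) => [y|//]; apply/eqP/h.
Qed.

(** The precedence of [a] is immaterial where this is applied: both arguments are then consistent
    with a common realization. *)
Definition join (a b : Psi V Y) : Psi V Y :=
  [ffun v => if a v is Some y then Some y else b v].

Lemma dom_join a b : dom (join a b) = dom a :|: dom b.
Proof. by apply/setP => v; rewrite !inE ffunE; case: (a v). Qed.

(* [X phi] is the information revealed by some observation process run on [phi]. *)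
Definition observation (X : Phi V Y -> Psi V Y) : Prop :=
  (forall phi, consistent phi (X phi)) /\
  (forall phi phi', consistent phi' (X phi) -> X phi' = X phi).

Lemma observation_sym X phi phi' : observation X ->
  consistent phi' (X phi) = consistent phi (X phi').
Proof.
by case=> h1 h2; apply/idP/idP => /h2 ->.
Qed.

Lemma consistent_join phi a b :
  consistent phi a -> consistent phi b -> consistent phi (join a b).
Proof.
move=> /consistentP ha /consistentP hb; apply/consistentP => v y.
rewrite ffunE; case e : (a v) => [z|]; last exact: hb.
by move=> [<-]; apply: ha.
Qed.

(** Where both are defined, [a] and [b] agree because [phi] extends both, so nothing recorded by [b]
    is lost in the join. *)
Lemma join_consistent phi phi' a b :
  consistent phi a -> consistent phi b -> consistent phi' (join a b) ->
  consistent phi' a /\ consistent phi' b.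
Proof.
move=> /consistentP ha /consistentP hb /consistentP hj.
split; apply/consistentP => v y e; first by apply: hj; rewrite ffunE e.
case ea : (a v) => [z|]; last by apply: hj; rewrite ffunE ea.
by rewrite -(hb _ _ e) (ha _ _ ea); apply: hj; rewrite ffunE ea.
Qed.

Lemma observation_join X Z :
  observation X -> observation Z -> observation (fun phi => join (X phi) (Z phi)).
Proof.
move=> [hX1 hX2] [hZ1 hZ2]; split=> [phi|phi phi' h].
  exact: consistent_join.
have [hx hz] := join_consistent _ _ _ _ (hX1 phi) (hZ1 phi) h.
by rewrite (hX2 _ _ hx) (hZ2 _ _ hz).
Qed.

Lemma runS s phi t : run s phi t.+1 = step s phi (run s phi t).
Proof. by []. Qed.

Lemma consistent_run s phi t : consistent phi (run s phi t).
Proof.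
elim: t => [|t IH]; first by apply/consistentP => v y; rewrite ffunE.
rewrite runS /step; case: (s _) => [v|//].
apply/consistentP => u y; rewrite ffunE; case: eqVneq => [-> [<-//]|_].
exact/consistentP.
Qed.

Lemma run_extends s phi t v y :
  run s phi t v = Some y -> run s phi t.+1 v = Some y.
Proof.
move=> e; rewrite runS /step; case: (s _) => [u|//].
rewrite ffunE; case: eqVneq => // <-.
by congr Some; move/consistentP: (consistent_run s phi t) => /(_ _ _ e).
Qed.

Lemma dom_step s phi t : dom (run s phi t.+1) =
  if s (run s phi t) is Some v then v |: dom (run s phi t) else dom (run s phi t).
Proof.
rewrite runS /step; case: (s _) => [v|//].
by apply/setP => u; rewrite in_setU1 !in_dom ffunE; case: (eqVneq u v).
Qed.

Lemma dom_run_le s phi t t' :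
  (t <= t')%N -> dom (run s phi t) \subset dom (run s phi t').
Proof.
elim: t' => [|t' IH]; first by rewrite leqn0 => /eqP ->.
rewrite leq_eqVlt => /predU1P[->//|]; rewrite ltnS => /IH /fintype.subset_trans; apply.
by rewrite dom_step; case: (s _) => // v; apply: finset.subsetUr.
Qed.

(** Consistency with the later state implies consistency with the earlier one, so by induction both
    runs select the same element, whose state is recorded and hence shared. *)
Lemma observation_run s t : observation (run s ^~ t).
Proof.
split=> [phi|phi phi']; first exact: consistent_run.
elim: t => [//|t IH] h.
have e : run s phi' t = run s phi t.
  apply: IH; apply/consistentP => v y /run_extends.
  by move/consistentP: h; apply.
rewrite !runS /step e; case es : (s _) => [v|//].
suff -> : phi' v = phi v by [].
move/consistentP: h; apply.
by rewrite runS /step es ffunE eqxx.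
Qed.

Lemma run_stuck s phi t t' : (t <= t')%N -> s (run s phi t) = None ->
  run s phi t' = run s phi t.
Proof.
move=> + e; elim: t' => [|t' IH]; first by rewrite leqn0 => /eqP ->.
rewrite leq_eqVlt => /predU1P[->//|]; rewrite ltnS => /IH h.
by rewrite runS h /step e.
Qed.

Definition active s psi : bool := isSome (s psi).

(** A valid policy selects a fresh element at every active time, so cost is a count of active times;
    this lets cost be compared with utility time by time. *)
Lemma card_dom_run s phi t : valid s ->
  #|dom (run s phi t)| = (\sum_(i < t) active s (run s phi i))%N.
Proof.
move=> vs; elim: t => [|t IH].
  by rewrite big_ord0; apply/eqP; rewrite cards_eq0; apply/eqP/setP=> v; rewrite !inE ffunE.
rewrite big_ord_recr /= -IH dom_step /active; case e : (s _) => [v|/=].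
  by rewrite cardsU1 in_dom (vs _ _ e) eqxx addnC.
by rewrite addn0.
Qed.

Lemma active_card s phi t : valid s -> active s (run s phi t) ->
  #|dom (run s phi t)| = t.
Proof.
move=> vs act; rewrite card_dom_run//.
under eq_bigr => i _.
  have -> : active s (run s phi i).
    apply: contraT; rewrite /active; case e : (s _) => [//|] _.
    by move: act; rewrite (run_stuck _ _ _ _ (ltnW (ltn_ord i)) e) /active e.
  over.
by rewrite sum1_card card_ord.
Qed.

(** Translates activity at time [t] into the time range over which [Delta_l] quantifies. *)
Lemma active_lt_card s phi t : valid s -> (t < #|V|)%N ->
  active s (run s phi t) -> (t < #|Esel s phi|)%N.
Proof.
move=> vs tV act.
apply: leq_trans (subset_leq_card (dom_run_le s phi _ _ tV)).
rewrite card_dom_run// big_ord_recr /= -card_dom_run// active_card//.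
by rewrite act addn1.
Qed.

Definition subpolicy (s' s : dpol V Y) : Prop :=
  forall psi, s' psi = s psi \/ s' psi = None.

Lemma subpolicy_valid s' s : subpolicy s' s -> valid s -> valid s'.
Proof. by move=> h vs psi v; case: (h psi) => -> //; apply: vs. Qed.

(** The two runs coincide until [s'] stops, and once stopped it stays stopped. *)
Lemma subpolicy_run s' s phi t : subpolicy s' s ->
  run s' phi t = run s phi t \/ ~~ active s' (run s' phi t).
Proof.
move=> h; elim: t => [|t IH]; first by left.
case e : (s' (run s' phi t)) => [v|]; last first.
  by right; rewrite runS /step e /active e.
case: IH => [IH|]; last by rewrite /active e.
left; rewrite !runS /step e -IH.
by case: (h (run s' phi t)) => h'; rewrite h' in e => //; rewrite e.
Qed.

Lemma subpolicy_active s' s phi t : subpolicy s' s ->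
  active s' (run s' phi t) ->
  run s' phi t = run s phi t /\ s' (run s' phi t) = s (run s phi t).
Proof.
move=> h act; case: (subpolicy_run s' s phi t h) => [e|]; last by rewrite act.
split=> //; rewrite -e; case: (h (run s' phi t)) => // h'.
by rewrite /active h' in act.
Qed.

Lemma subpolicy_card s' s phi : subpolicy s' s -> valid s ->
  (#|Esel s' phi| <= #|Esel s phi|)%N.
Proof.
move=> h vs; have vs' := subpolicy_valid _ _ h vs.
rewrite /Esel /final !card_dom_run//; apply: leq_sum => i _.
case act : (active s' _) => //.
have [e1 e2] := subpolicy_active _ _ _ _ h act.
by move: act; rewrite /active e2 => ->.
Qed.

End PartialRealizations.

(** * Expected utility and cost under the prior *)

Section Averages.
Context {V Y : finType} {R : realType}.
Context (p : Phi V Y -> R) (f : {set V} -> Phi V Y -> R).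
Hypothesis p_prior : is_prior p.
Hypothesis f_mono : adaptive_monotone p f.
Implicit Types (s : dpol V Y) (phi : Phi V Y) (psi : Psi V Y) (w : dpol V Y -> R).

Lemma prior_ge0 phi : 0 <= p phi. Proof. by case: p_prior. Qed.
Hint Resolve prior_ge0 : core.

Lemma PrC_ge0 psi : 0 <= PrC p psi.
Proof. by apply: sumr_ge0. Qed.

Lemma PrC_gt0 psi phi : 0 < p phi -> consistent phi psi -> 0 < PrC p psi.
Proof.
move=> p0 h; rewrite /PrC (bigD1 phi)//=.
by rewrite ltr_pwDl// sumr_ge0.
Qed.

(** Law of total expectation. Having the same observation is an equivalence relation, and [F]
    depends on its first argument only through the class, so the two sums can be exchanged. *)
Lemma tower X (F : Phi V Y -> Phi V Y -> R) : observation X ->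
  (forall phi phi', consistent phi' (X phi) -> F phi =1 F phi') ->
  \sum_phi p phi * ((\sum_(phi' | consistent phi' (X phi)) p phi' * F phi phi')
                      / PrC p (X phi)) = \sum_phi p phi * F phi phi.
Proof.
move=> oX hF; have [oX1 oX2] := oX.
transitivity (\sum_phi \sum_(phi' | consistent phi' (X phi))
    p phi * p phi' * F phi' phi' / PrC p (X phi')).
  apply: eq_bigr => phi _; rewrite mulr_suml mulr_sumr.
  apply: eq_bigr => phi' h.
  by rewrite (hF _ _ h) (oX2 _ _ h) !mulrA.
rewrite (exchange_big_dep predT)//=; apply: eq_bigr => phi _.
under eq_bigl => phi' do rewrite (observation_sym X)//.
under eq_bigr => phi' _ do rewrite -!mulrA.
rewrite -mulr_suml -/(PrC p (X phi)).
(* The normalizing factor can vanish only when [p phi] does, and then both sides are zero. *)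
have := prior_ge0 phi; rewrite le_eqVlt => /predU1P[<-|p0].
  by rewrite !mul0r mulr0.
have h : PrC p (X phi) != 0 by rewrite gt_eqF// (PrC_gt0 _ phi).
by rewrite mulrCA; congr (_ * _); rewrite mulrCA divff// mulr1.
Qed.

(** Adaptive monotonicity covers fresh elements; for an already observed one every increment is
    zero. *)
Lemma Delta_ge0 v psi : 0 <= Delta p f v psi.
Proof.
have [vd|/f_mono//] := boolP (v \in dom psi).
rewrite /Delta big1 ?mul0r// => phi _.
rewrite (_ : v |: dom psi = dom psi) ?subrr ?mulr0//.
by apply/finset.setUidPr; rewrite finset.sub1set.
Qed.

(** The value 0 after termination lets sums over time run over the full horizon [#|V|]. *)
Definition gain s psi : R := if s psi is Some v then Delta p f v psi else 0.

(** [X] may reveal more than the run of [s]. Given [X phi] the selection of [s] at time [t] is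
    determined, so [tower] replaces the actual increment by its conditional mean. *)
Lemma mean_step X s t : observation X ->
  (forall phi phi', consistent phi' (X phi) -> run s phi' t = run s phi t) ->
  \sum_phi p phi * (if s (run s phi t) is Some v then
      f (v |: dom (X phi)) phi - f (dom (X phi)) phi else 0) =
  \sum_phi p phi * (if s (run s phi t) is Some v then Delta p f v (X phi) else 0).
Proof.
move=> oX hX; have [_ oX2] := oX.
rewrite -(tower X (fun phi phi' => if s (run s phi t) is Some v then
      f (v |: dom (X phi)) phi' - f (dom (X phi)) phi' else 0))//; last first.
  by move=> phi phi' h phi''; rewrite (hX _ _ h) (oX2 _ _ h).
apply: eq_bigr => phi _; congr (_ * _); case: (s _) => [//|].
by rewrite big1 ?mul0r// => ? _; rewrite mulr0.
Qed.

Definition mean_util s : R := \sum_phi p phi * f (Esel s phi) phi.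
Definition mean_cost s : R := \sum_phi p phi * (#|Esel s phi|)%:R.

Lemma mean_utilE s : mean_util s = \sum_phi p phi * f finset.set0 phi +
  \sum_(t < #|V|) \sum_phi p phi * gain s (run s phi t).
Proof.
rewrite /mean_util /Esel /final; elim: #|V| => [|m IH].
  rewrite big_ord0 addr0; apply: eq_bigr => phi _; congr (_ * f _ _).
  by apply/setP => v; rewrite in_dom !inE ffunE.
rewrite big_ord_recr /= addrA -IH /gain -(mean_step (run s ^~ m))//; first last.
- by move=> phi phi'; apply: (observation_run s m).2.
- exact: observation_run.
rewrite -big_split; apply: eq_bigr => phi _ /=.
rewrite dom_step; case: (s _) => [v|]; last by rewrite mulr0 addr0.
by rewrite -mulrDr addrC subrK.
Qed.

Lemma mean_costE s : valid s ->
  mean_cost s = \sum_(t < #|V|) \sum_phi p phi * (active s (run s phi t))%:R.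
Proof.
move=> vs; rewrite exchange_big /=; apply: eq_bigr => phi _.
by rewrite -mulr_sumr /Esel /final card_dom_run// natr_sum.
Qed.

Lemma mean_cost_ge0 s : 0 <= mean_cost s.
Proof. by apply: sumr_ge0 => phi _; rewrite mulr_ge0. Qed.

(** While [s'] is active both policies earn the same; afterwards each unit of cost paid by [s] earns
    at least [u]. *)
Lemma subpolicy_gain (u : R) s' s : subpolicy s' s -> valid s ->
  (forall phi, 0 < p phi -> forall t v, (t < #|Esel s phi|)%N ->
     s (run s phi t) = Some v -> u <= Delta p f v (run s phi t)) ->
  mean_util s' - u * mean_cost s' <= mean_util s - u * mean_cost s.
Proof.
move=> h vs hu; have vs' := subpolicy_valid _ _ h vs.
rewrite !mean_utilE !mean_costE// -!addrA lerD2l !mulr_sumr -!sumrB.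
apply: ler_sum => t _; rewrite !mulr_sumr -!sumrB.
apply: ler_sum => phi _; rewrite ![u * _]mulrCA -!mulrBr.
have := prior_ge0 phi; rewrite le_eqVlt => /predU1P[<-|p0]; first by rewrite !mul0r.
rewrite ler_pM2l//.
have [act'|nact'] := boolP (active s' (run s' phi t)).
  have [e1 e2] := subpolicy_active _ _ _ _ h act'.
  by move: act'; rewrite /active /gain e2 e1 => ->.
rewrite /gain; move: nact'; rewrite /active; case: (s' _) => // _.
rewrite mulr0 subr0; case e : (s _) => [v|] /=; last by rewrite mulr0 subr0.
rewrite mulr1 subr_ge0; apply: hu => //.
by apply: active_lt_card => //; rewrite /active e.
Qed.

(** The selections of [s0] are added one at a time to a finished run of [s]; each has non-negative
    expected gain given all that has been observed. *)
Lemma mean_util_union s s0 :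
  mean_util s <= \sum_phi p phi * f (Esel s phi :|: Esel s0 phi) phi.
Proof.
rewrite /mean_util [X in _ <= X](_ : _ =
  \sum_phi p phi * f (Esel s phi :|: dom (run s0 phi #|V|)) phi)//.
elim: #|V| => [|m IH].
  rewrite le_eqVlt; apply/orP; left; apply/eqP.
  apply: eq_bigr => phi _; congr (_ * f _ _).
  by apply/setP => v; rewrite finset.in_setU [in X in _ || X]in_dom ffunE orbF.
apply: le_trans IH _; rewrite -subr_ge0 -sumrB.
(* The knowledge held after all of [s] and the first [m] steps of [s0]. *)
pose X phi := join (final s phi) (run s0 phi m).
have oX : observation X by apply: observation_join; apply: observation_run.
have hX phi phi' : consistent phi' (X phi) -> run s0 phi' m = run s0 phi m.
  move=> /(join_consistent _ _ _ _ (consistent_run _ _ _) (consistent_run _ _ _))[_].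
  exact: (observation_run s0 m).2.
rewrite [X in 0 <= X](_ : _ = \sum_phi p phi * (if s0 (run s0 phi m) is Some v then
      f (v |: dom (X phi)) phi - f (dom (X phi)) phi else 0)).
  rewrite mean_step//; apply: sumr_ge0 => phi _; apply: mulr_ge0 => //.
  by case: (s0 _) => // v; apply: Delta_ge0.
apply: eq_bigr => phi _; rewrite dom_step dom_join /Esel -mulrBr; congr (_ * _).
by case: (s0 _) => [v|]; rewrite ?subrr// finset.setUCA.
Qed.

(** Conditioning on the observations of [s] at termination turns the extra utility brought by [w]
    into [DeltaPol]. *)
Lemma union_gain w s : is_policy w ->
  \sum_s0 w s0 * \sum_phi p phi * f (Esel s0 phi :|: Esel s phi) phi =
  mean_util s + \sum_phi p phi * DeltaPol p f w (final s phi).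
Proof.
move=> [w0 w1 _].
pose F phi phi' := \sum_s0 w s0 *
  (f (Esel s0 phi' :|: dom (final s phi)) phi' - f (dom (final s phi)) phi').
have oX : observation (final s) by apply: observation_run.
transitivity (mean_util s + \sum_phi p phi * F phi phi).
  transitivity (\sum_phi p phi * \sum_s0 w s0 * f (Esel s0 phi :|: Esel s phi) phi).
    under eq_bigr => s0 _ do rewrite mulr_sumr.
    rewrite exchange_big /=; apply: eq_bigr => phi _; rewrite mulr_sumr.
    by apply: eq_bigr => s0 _; rewrite mulrCA.
  rewrite /mean_util -big_split /=; apply: eq_bigr => phi _.
  rewrite -mulrDr; congr (_ * _); rewrite /F.
  under [in RHS]eq_bigr => s0 _ do rewrite mulrBr.
  by rewrite sumrB -mulr_suml w1 mul1r addrC subrK.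
congr (_ + _); rewrite -(tower (final s) F)//; last first.
  by move=> phi phi' h phi''; rewrite /F (oX.2 _ _ h).
apply: eq_bigr => phi _; congr (_ * (_ / _)); rewrite /F.
under eq_bigr => phi' _ do rewrite mulr_sumr.
rewrite exchange_big /=; apply: eq_bigr => s0 _; rewrite mulr_sumr.
by apply: eq_bigr => phi' _; rewrite mulrCA.
Qed.

Lemma mean_PrSel w s :
  \sum_phi p phi * \sum_v PrSel p w v (final s phi) = c_avg p w.
Proof.
pose F phi phi' : R := \sum_s0 w s0 * (#|Esel s0 phi'|)%:R : R.
have oX : observation (final s) by apply: observation_run.
transitivity (\sum_phi p phi * F phi phi); last first.
  rewrite /c_avg /F; under eq_bigr => phi _ do rewrite mulr_sumr.
  rewrite exchange_big /=; apply: eq_bigr => s0 _; rewrite mulr_sumr.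
  by apply: eq_bigr => phi _; rewrite mulrCA.
rewrite -(tower (final s) F)//; apply: eq_bigr => phi _; congr (_ * _).
rewrite /PrSel -mulr_suml; congr (_ / _).
rewrite exchange_big /= /F.
under [RHS]eq_bigr => phi' _ do rewrite mulr_sumr.
rewrite [RHS]exchange_big /=; apply: eq_bigr => s0 _.
rewrite -mulr_sumr.
under [RHS]eq_bigr => phi' _ do rewrite mulrCA.
rewrite -mulr_sumr; congr (_ * _).
under eq_bigr => v _ do rewrite big_mkcondr.
rewrite exchange_big /=; apply: eq_bigr => phi' _.
rewrite -big_mkcond /= sumr_const mulr_natr; congr (_ *+ _).
Qed.

Lemma PrSel_ge0 w v psi : is_policy w -> 0 <= PrSel p w v psi.
Proof.
move=> [w0 _ _]; apply: divr_ge0; last exact: PrC_ge0.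
by apply: sumr_ge0 => s _; apply: mulr_ge0 => //; apply: sumr_ge0.
Qed.

(** Adding the elements of [s] to those of [w] does not lower utility on average. Seen from the end
    of [s], the addition made by [w] costs [c_avg p w] on average, each unit being worth at most
    [U / g]. *)
Lemma f_avg_le_final (g U : R) w s : is_policy w -> 0 < g ->
  (forall phi, 0 < p phi -> g * DeltaPol p f w (final s phi) <=
     \sum_v PrSel p w v (final s phi) * Delta p f v (final s phi)) ->
  (forall phi, 0 < p phi -> forall v, Delta p f v (final s phi) <= U) ->
  f_avg p f w <= mean_util s + U / g * c_avg p w.
Proof.
move=> pw g0 hg hU; have [w0 w1 _] := pw.
apply: (@le_trans _ _ (\sum_s0 w s0 *
   \sum_phi p phi * f (Esel s0 phi :|: Esel s phi) phi)).
  by apply: ler_sum => s0 _; apply: ler_wpM2l => //; apply: mean_util_union.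
rewrite union_gain// lerD2l -(mean_PrSel w s) mulr_sumr; apply: ler_sum => phi _.
have := prior_ge0 phi; rewrite le_eqVlt => /predU1P[<-|p0]; first by rewrite !mul0r mulr0.
rewrite [X in _ <= X]mulrCA ler_pM2l// mulrAC ler_pdivlMr// [X in X <= _]mulrC.
apply: le_trans (hg _ p0) _; rewrite mulr_sumr; apply: ler_sum => v _.
by rewrite [X in X <= _]mulrC; apply: ler_wpM2r; [exact: PrSel_ge0|exact: hU].
Qed.

End Averages.

(** * Threshold sub-policies: monotonicity, existence and gain per cost *)

Section Thresholds.
Context {V Y : finType} {R : realType}.
Context (p : Phi V Y -> R) (f : {set V} -> Phi V Y -> R).
Hypothesis p_prior : is_prior p.
Hypothesis f_mono : adaptive_monotone p f.
Implicit Types (s : dpol V Y) (phi : Phi V Y) (psi : Psi V Y) (w : dpol V Y -> R).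

Local Notation cut := (trunc p f).

Lemma trunc_subpolicy s (tau : R) b : subpolicy (cut s tau b) s.
Proof. by move=> psi; rewrite ffunE; case: ifP => _; [right|left]. Qed.

(** A larger threshold stops no later, and at equal thresholds the non-strict test ([false]) stops
    no later than the strict one. *)
Lemma trunc_le s (tau tau' : R) b b' :
  (tau' < tau) || (tau' == tau) && (b ==> b') ->
  subpolicy (cut s tau b) (cut s tau' b').
Proof.
move=> h psi; rewrite !ffunE; case: ifP => H; first by right.
rewrite ifF; first by left.
apply: contraFF H => /forallP H; apply/forallP => v; apply/implyP => hv.
move: {H}(H v) => /implyP/(_ hv); case/orP: h => [h|/andP[/eqP <-]]; last first.
  by case: b b' => [] [] //= _; apply: ltW.
have {}h x : x <= tau' -> x < tau by move/le_lt_trans; apply.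
by case: b' => [/ltW|] /h h'; case: b => //; apply: ltW.
Qed.

Lemma trunc_eq s (tau tau' : R) :
  (forall v psi, (Delta p f v psi < tau) = (Delta p f v psi <= tau')) ->
  cut s tau true = cut s tau' false.
Proof.
move=> h; apply/ffunP => psi; rewrite !ffunE.
by under eq_forallb => v do rewrite h.
Qed.

(** Gains are non-negative, so the strict test at 0 fails as long as an unselected element
    remains. *)
Lemma trunc0 s : valid s -> cut s 0 true = s.
Proof.
move=> vs; apply/ffunP => psi; rewrite !ffunE; case: ifP => // /forallP H.
case e : (s psi) => [v|//]; have := H v.
rewrite finset.in_setC in_dom (vs _ _ e) /= ltNge Delta_ge0//.
Qed.

Lemma mean_cost_stopped s : (forall psi, s psi = None) -> mean_cost p s = 0.
Proof.
move=> h; rewrite mean_costE; last by move=> psi v; rewrite h.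
by rewrite big1// => t _; rewrite big1// => phi _; rewrite /active h mulr0.
Qed.

Lemma tsub_sum w (tau rho : R) (G : dpol V Y -> R) :
  \sum_s tsub p f w tau rho s * G s =
  rho * (\sum_s w s * G (cut s tau true)) +
  (1 - rho) * (\sum_s w s * G (cut s tau false)).
Proof.
have D b : \sum_s (\sum_s1 w s1 * (cut s1 tau b == s)%:R) * G s =
    \sum_s w s * G (cut s tau b).
  under eq_bigr => s _ do rewrite mulr_suml.
  rewrite exchange_big /=; apply: eq_bigr => s _.
  rewrite (bigD1 (cut s tau b))//= eqxx mulr1 big1 ?addr0// => s' ne.
  by rewrite eq_sym (negPf ne) mulr0 mul0r.
rewrite -!D !mulr_sumr -big_split /=; apply: eq_bigr => s _.
rewrite !mulrA -mulrDl; congr (_ * _); rewrite !mulr_sumr -big_split /=.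
by apply: eq_bigr => s1 _; ring.
Qed.

Lemma tsub_supp w (tau rho : R) s' : is_policy w -> 0 <= rho <= 1 ->
  0 < tsub p f w tau rho s' -> exists s b, 0 < w s /\ s' = cut s tau b.
Proof.
move=> [w0 _ _] /andP[r0 r1]; rewrite /tsub => h.
have /existsP[s] : [exists s, 0 < w s * (rho * (cut s tau true == s')%:R
    + (1 - rho) * (cut s tau false == s')%:R)].
  apply: contraLR h; rewrite negb_exists => /forallP h.
  by rewrite -leNgt; apply: sumr_le0 => s _; rewrite leNgt.
have := w0 s; rewrite le_eqVlt => /predU1P[<-|ws]; first by rewrite mul0r ltxx.
have [<- _|_] := eqVneq (cut s tau true) s'; first by exists s, true.
have [<- _|_] := eqVneq (cut s tau false) s'; first by exists s, false.
by rewrite !mulr0 addr0 mulr0 ltxx.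
Qed.

Lemma tsub_gt0 w (tau rho : R) s b : is_policy w -> 0 <= rho <= 1 ->
  0 < w s -> 0 < (if b then rho else 1 - rho) -> 0 < tsub p f w tau rho (cut s tau b).
Proof.
move=> [w0 _ _] /andP[r0 r1] ws hb; rewrite /tsub (bigD1 s)//=.
have h s1 : 0 <= w s1 * (rho * (cut s1 tau true == cut s tau b)%:R +
    (1 - rho) * (cut s1 tau false == cut s tau b)%:R).
  by apply: mulr_ge0 => //; apply: addr_ge0; apply: mulr_ge0 => //; rewrite subr_ge0.
apply: ltr_pwDl; last exact: sumr_ge0.
apply: mulr_gt0 => //; case: b hb {h} => hb; rewrite eqxx mulr1.
  by apply: ltr_pwDl => //; apply: mulr_ge0 => //; rewrite subr_ge0.
by apply: ltr_wpDl => //; apply: mulr_ge0.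
Qed.

Lemma tsub_policy w (tau rho : R) : is_policy w -> 0 <= rho <= 1 ->
  is_policy (tsub p f w tau rho).
Proof.
move=> pw r01; have [w0 w1 wv] := pw; have /andP[r0 r1] := r01; split.
- move=> s; apply: sumr_ge0 => s1 _; apply: mulr_ge0 => //.
  by apply: addr_ge0; apply: mulr_ge0 => //; rewrite subr_ge0.
- have := tsub_sum w tau rho (fun=> 1); under eq_bigr => s _ do rewrite mulr1.
  move=> ->; under eq_bigr => s _ do rewrite mulr1.
  by rewrite w1 !mulr1; ring.
move=> s' /(tsub_supp _ _ _ _ pw r01)[s [b [ws ->]]].
exact: subpolicy_valid (trunc_subpolicy _ _ _) (wv _ ws).
Qed.

Definition cut_cost w (tau : R) b : R := \sum_s w s * mean_cost p (cut s tau b).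
Definition cut_util w (tau : R) b : R := \sum_s w s * mean_util p f (cut s tau b).

Lemma c_avg_tsub w (tau rho : R) : c_avg p (tsub p f w tau rho) =
  rho * cut_cost w tau true + (1 - rho) * cut_cost w tau false.
Proof. exact: tsub_sum. Qed.

Lemma f_avg_tsub w (tau rho : R) : f_avg p f (tsub p f w tau rho) =
  rho * cut_util w tau true + (1 - rho) * cut_util w tau false.
Proof. exact: tsub_sum. Qed.

(** Makes a policy its own threshold sub-policy as far as averages go, which places [pi] at the top
    of the chain of the [pi_i]. *)
Lemma tsub0 w : is_policy w ->
  c_avg p (tsub p f w 0 1) = c_avg p w /\ f_avg p f (tsub p f w 0 1) = f_avg p f w.
Proof.
move=> [w0 _ wv]; rewrite c_avg_tsub f_avg_tsub !mul1r subrr !mul0r !addr0.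
by split; apply: eq_bigr => s _; have := w0 s;
  rewrite le_eqVlt => /predU1P[<-|/wv vs]; rewrite ?mul0r// trunc0.
Qed.

(* The cost is a step function of the threshold, jumping only at values of [Delta]. *)
Lemma threshold_above w (tau x : R) : 0 <= x -> x < cut_cost w tau false ->
  exists2 tau', tau < tau' & cut_cost w tau' false <= x < cut_cost w tau' true.
Proof.
move=> x0; have [m] := ubnP #|[set vpsi : V * Psi V Y | tau < Delta p f vpsi.1 vpsi.2]|.
elim: m tau => // m IH tau; rewrite ltnS => card hx.
have [[[v0 psi0] h0]|no] := pselect (exists vp : V * Psi V Y, tau < Delta p f vp.1 vp.2);
    last first.
  move: hx; rewrite /cut_cost big1 ?ltNge ?x0// => s _.
  rewrite mean_cost_stopped ?mulr0// => psi; rewrite ffunE ifT//.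
  apply/forallP => v; apply/implyP => _.
  by rewrite leNgt; apply/negP => h; apply: no; exists (v, psi).
case: (@Order.TotalTheory.arg_minP _ _ _ (v0, psi0) (fun vp => tau < Delta p f vp.1 vp.2)
  (fun vp => Delta p f vp.1 vp.2) h0) => -[v1 psi1] /= h1 hmin.
set tau1 := Delta p f v1 psi1 in h1 hmin.
have e : cut_cost w tau1 true = cut_cost w tau false.
  apply: eq_bigr => s _; congr (_ * mean_cost _ _); apply: trunc_eq => v psi.
  apply/idP/idP => [h|/le_lt_trans->//].
  rewrite leNgt; apply: contraL h => h; rewrite -leNgt.
  exact: (hmin (v, psi)).
have [h|h] := leP (cut_cost w tau1 false) x.
  by exists tau1 => //; rewrite h e hx.
have [||tau' ht' h'] := IH tau1 => //.
  apply: leq_trans card; apply: proper_card; apply/properP; split.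
    by apply/fintype.subsetP => vp; rewrite !inE; apply: lt_trans.
  by exists (v1, psi1); rewrite inE //= ltxx.
by exists tau' => //; apply: lt_trans ht'.
Qed.

Definition dominates (tau rho tau' rho' : R) : Prop :=
  tau < tau' \/ tau' = tau /\ rho' <= rho.

Lemma tsub_below w (tau rho x : R) : 0 <= rho <= 1 -> 0 <= x ->
  x < c_avg p (tsub p f w tau rho) ->
  exists tau' rho', [/\ dominates tau rho tau' rho', 0 <= rho' <= 1 &
    c_avg p (tsub p f w tau' rho') = x].
Proof.
move=> /andP[r0 r1] x0; rewrite c_avg_tsub => hx.
set a := cut_cost w tau true in hx; set b := cut_cost w tau false in hx.
have [hb|hb] := leP b x.
  have ab : 0 < a - b by nra.
  exists tau, ((x - b) / (a - b)); split.
  - right; split=> //; rewrite ler_pdivrMr//; lra.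
  - rewrite ler_pdivrMr// divr_ge0 ?subr_ge0//=; [|lra].
    have : rho * (a - b) <= a - b by rewrite ler_piMl// ltW.
    lra.
  - by rewrite c_avg_tsub -/a -/b; field; rewrite gt_eqF.
have [tau' ht /andP[h1 h2]] := threshold_above w tau x x0 hb.
set a' := cut_cost w tau' true in h2; set b' := cut_cost w tau' false in h1.
have ab : 0 < a' - b' by lra.
exists tau', ((x - b') / (a' - b')); split; first by left.
- by rewrite ler_pdivrMr// divr_ge0 ?subr_ge0//=; lra.
- by rewrite c_avg_tsub -/a' -/b'; field; rewrite gt_eqF.
Qed.

Lemma tsub_gain w (u tau rho tau' rho' : R) : is_policy w ->
  0 <= rho <= 1 -> 0 <= rho' <= 1 -> dominates tau rho tau' rho' ->
  (forall s phi, 0 < tsub p f w tau rho s -> 0 < p phi ->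
     forall t v, (t < #|Esel s phi|)%N -> s (run s phi t) = Some v ->
     u <= Delta p f v (run s phi t)) ->
  u * (c_avg p (tsub p f w tau rho) - c_avg p (tsub p f w tau' rho')) <=
  f_avg p f (tsub p f w tau rho) - f_avg p f (tsub p f w tau' rho').
Proof.
move=> pw r01 r01' dom hu; have [w0 _ wv] := pw.
have H b t1 b1 : 0 < (if b then rho else 1 - rho) ->
    (tau < t1) || (tau == t1) && (b1 ==> b) ->
    cut_util w t1 b1 - u * cut_cost w t1 b1 <= cut_util w tau b - u * cut_cost w tau b.
  move=> hb hle; rewrite /cut_util /cut_cost !mulr_sumr -!sumrB.
  apply: ler_sum => s _; rewrite ![u * _]mulrCA -!mulrBr.
  have := w0 s; rewrite le_eqVlt => /predU1P[<-|ws]; first by rewrite !mul0r.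
  rewrite ler_pM2l//; apply: subpolicy_gain => //.
  - exact: trunc_le.
  - exact: subpolicy_valid (trunc_subpolicy _ _ _) (wv _ ws).
  - by move=> phi p0; apply: hu => //; apply: tsub_gt0.
rewrite !c_avg_tsub !f_avg_tsub.
have /andP[r0 r1] := r01; have /andP[r0' r1'] := r01'.
case: dom => [lt|[e hr]].
  have HH b1 : cut_util w tau' b1 - u * cut_cost w tau' b1 <=
     rho * (cut_util w tau true - u * cut_cost w tau true) +
     (1 - rho) * (cut_util w tau false - u * cut_cost w tau false).
    have := H true tau' b1; have := H false tau' b1; rewrite lt /= => Hf1 Ht1.
    move: r0; rewrite le_eqVlt => /predU1P[e|r0].
      by move: Hf1; rewrite -e subr0 => /(_ ltr01 isT); lra.
    move: r1; rewrite le_eqVlt => /predU1P[e|r1].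
      by move: Ht1; rewrite e => /(_ ltr01 isT); lra.
    rewrite -subr_gt0 in r1.
    by have := Hf1 r1 isT; have := Ht1 r0 isT; nra.
  have := HH true; have := HH false; nra.
rewrite e in H *.
move: hr; rewrite le_eqVlt => /predU1P[->|hr]; first by lra.
have := H true tau false (le_lt_trans r0' hr); rewrite eqxx orbT => /(_ isT).
nra.
Qed.

End Thresholds.

Section Ratios.
Context {V Y : finType} {R : realType}.
Context (p : Phi V Y -> R) (f : {set V} -> Phi V Y -> R).
Hypothesis p_prior : is_prior p.
Hypothesis f_mono : adaptive_monotone p f.
Implicit Types (s : dpol V Y) (phi : Phi V Y) (psi : Psi V Y) (w : dpol V Y -> R).

Lemma c_avg_ge0 w : is_policy w -> 0 <= c_avg p w.
Proof.
by move=> [w0 _ _]; apply: sumr_ge0 => s _; apply: mulr_ge0 => //; apply: mean_cost_ge0.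
Qed.

Lemma f_avg_ge0 w : is_policy w -> (forall S phi, 0 <= f S phi) -> 0 <= f_avg p f w.
Proof.
move=> [w0 _ _] f0; apply: sumr_ge0 => s _; apply: mulr_ge0 => //.
by apply: sumr_ge0 => phi _; apply: mulr_ge0 => //; apply: prior_ge0.
Qed.

Lemma cost_selects w : is_policy w -> 0 < c_avg p w ->
  exists s phi t v, [/\ 0 < w s, 0 < p phi, (t < #|Esel s phi|)%N &
    s (run s phi t) = Some v].
Proof.
move=> [w0 _ wv]; apply: contraPP => no; apply/negP; rewrite -leNgt.
apply: sumr_le0 => s _; have := w0 s; rewrite le_eqVlt => /predU1P[<-|ws].
  by rewrite mul0r.
rewrite pmulr_rle0//; apply: sumr_le0 => phi _.
have := prior_ge0 p p_prior phi; rewrite le_eqVlt => /predU1P[<-|p0].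
  by rewrite mul0r.
rewrite pmulr_rle0// (_ : #|Esel s phi| = 0%N)//.
rewrite /Esel /final card_dom_run; last exact: wv.
apply: big1 => t _; apply/eqP; rewrite eqb0; apply/negP => act.
apply: no; have lt := active_lt_card _ _ _ (wv _ ws) (ltn_ord t) act.
by move: act; rewrite /active; case e : (s _) => [v|//] _; exists s, phi, t, v.
Qed.

Lemma beta_bounds w (tau rho : R) (i : nat) : is_policy w -> 0 <= tau ->
  0 <= rho <= 1 -> c_avg p (tsub p f w tau rho) = i%:R -> (0 < i)%N ->
  i%:R <= c_avg p w -> beta_ratio p f w \is a fin_num ->
  exists L : R, [/\ 0 < L,
   forall s phi, 0 < tsub p f w tau rho s -> 0 < p phi ->
     forall t v, (t < #|Esel s phi|)%N -> s (run s phi t) = Some v ->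
     L <= Delta p f v (run s phi t),
   forall s phi, 0 < tsub p f w tau rho s -> 0 < p phi ->
     forall v, Delta p f v (final s phi) <= fine (beta_ratio p f w) * L
   & 0 <= fine (beta_ratio p f w)].
Proof.
move=> pw tau0 r01 cw i0 iw bfin.
set w' := tsub p f w tau rho in cw *.
have pw' : is_policy w' by apply: tsub_policy.
have [s1 [phi1 [t1 [v1 [ws1 p1 lt1 e1]]]]] : exists s phi t v,
    [/\ 0 < w' s, 0 < p phi, (t < #|Esel s phi|)%N & s (run s phi t) = Some v].
  by apply: cost_selects => //; rewrite cw ltr0n.
have hb : (eratio (Delta_u p f w') (Delta_l p f w') <= beta_ratio p f w)%E.
  apply: ereal_sup_ubound; exists w' => //; exists i; split=> //.
  by exists tau, rho; split.
have hl s phi t v : 0 < w' s -> 0 < p phi -> (t < #|Esel s phi|)%N ->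
    s (run s phi t) = Some v -> (Delta_l p f w' <= (Delta p f v (run s phi t))%:E)%E.
  move=> ws p0 lt e; apply: ge_ereal_sup => _ [u hu <-].
  by rewrite lee_fin; apply: hu.
have hu s phi v : 0 < w' s -> 0 < p phi ->
    ((Delta p f v (final s phi))%:E <= Delta_u p f w')%E.
  move=> ws p0; apply: le_ereal_inf_tmp => _ [u hu <-].
  by rewrite lee_fin; apply: hu.
rewrite -(fineK bfin) in hb.
move: hb hl; case: (Delta_l p f w') => [L| |] /=; last 2 first.
- by move=> _ /(_ _ _ _ _ ws1 p1 lt1 e1).
- by [].
case: ifPn => // L0 hb hl; exists L.
have hU s phi v : 0 < w' s -> 0 < p phi ->
    Delta p f v (final s phi) <= fine (beta_ratio p f w) * L.
  move=> ws p0; rewrite -lee_fin [(_ * L)%:E]EFinM -lee_pdivrMr//.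
  apply: le_trans hb; rewrite lee_pmul2r ?lte_fin ?invr_gt0//; exact: hu.
split=> //.
- by move=> s phi ws p0 t v lt e; rewrite -lee_fin; apply: hl.
- by move=> s phi ws p0 v; apply: hU.
have := hU s1 phi1 v1 ws1 p1; have := Delta_ge0 p f f_mono v1 (final s1 phi1).
by move=> /le_trans h /h; rewrite pmulr_lge0.
Qed.

Lemma gamma_bound (n k : nat) psi w : is_policy w -> (height w <= k)%N ->
  (#|dom psi| <= n)%N -> gamma_s p f n k \is a fin_num ->
  fine (gamma_s p f n k) * DeltaPol p f w psi <=
    \sum_v PrSel p w v psi * Delta p f v psi \/ DeltaPol p f w psi <= 0.
Proof.
move=> pw hw hn gfin; have [h|h] := leP (DeltaPol p f w psi) 0; first by right.
left; rewrite -ler_pdivlMr// -lee_fin fineK//.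
by apply: ereal_inf_lbound; exists psi, psi, w; split=> //; split.
Qed.

End Ratios.

Lemma card_le_height {V Y : finType} {R : realType} (w : dpol V Y -> R) s phi :
  0 < w s -> (#|Esel s phi| <= height w)%N.
Proof.
move=> ws; rewrite /height (bigD1 s)//=; apply: leq_trans (leq_maxl _ _).
by rewrite (bigD1 phi)//= leq_maxl.
Qed.

Theorem theorem1 (V Y : finType) (R : realType)
  (p : Phi V Y -> R) (f : {set V} -> Phi V Y -> R)
  (pi pi' pistar : dpol V Y -> R) (tau rho : R) (l n k : nat) :
  is_prior p ->
  (forall (S : {set V}) (phi : Phi V Y), 0 <= f S phi) ->
  adaptive_monotone p f ->
  is_policy pi' ->
  0 <= tau -> 0 <= rho <= 1 ->
  pi = tsub p f pi' tau rho ->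
  c_avg p pi = l%:R ->
  l%:R <= c_avg p pi' ->
  height pi = n ->
  is_policy pistar ->
  height pistar = k ->
  beta_ratio p f pi \is a fin_num ->
  gamma_s p f n k \is a fin_num ->
  (0 < gamma_s p f n k)%E ->
  f_avg p f pi >=
    (1 - expR (- (l%:R /
        (fine (beta_ratio p f pi) / fine (gamma_s p f n k) * c_avg p pistar + 1))))
    * f_avg p f pistar.
Proof.
move=> pp f0 fm pw' tau0 r01 piE cpi _ hn ps hk bfin gfin g0.
have pw : is_policy pi by rewrite piE; apply: tsub_policy.
set b := fine (beta_ratio p f pi); set g := fine (gamma_s p f n k).
set c := c_avg p pistar; set F := f_avg p f pistar.
have g_gt0 : 0 < g by apply: fine_gt0; rewrite g0 ltey_eq gfin.
have c0 : 0 <= c by exact: c_avg_ge0.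
have F0 : 0 <= F by exact: f_avg_ge0.
have r11 : 0 <= (1 : R) <= 1 by rewrite ler01 lexx.
have [cpi1 fpi1] := tsub0 p f fm _ pw.
have gap j t r : (0 < j)%N -> (j <= l)%N -> 0 <= t -> 0 <= r <= 1 ->
    c_avg p (tsub p f pi t r) = j%:R -> exists L, [/\ 0 < L,
    forall s phi, 0 < tsub p f pi t r s -> 0 < p phi ->
      forall t v, (t < #|Esel s phi|)%N -> s (run s phi t) = Some v ->
      L <= Delta p f v (run s phi t),
    F <= f_avg p f (tsub p f pi t r) + b / g * c * L & 0 <= b].
  move=> j0 jl t0 r0 cj.
  have [|L [L0 hL hU hb]] := beta_bounds p f pp fm _ _ _ _ pw t0 r0 cj j0 _ bfin.
    by rewrite cpi ler_nat.
  exists L; split=> //.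
  have pwj : is_policy (tsub p f pi t r) by apply: tsub_policy.
  have [wj0 wj1 _] := pwj.
  rewrite -[F]mul1r -wj1 -[X in _ <= _ + X]mul1r -wj1 !mulr_suml -big_split /=.
  apply: ler_sum => s _; rewrite -mulrDr.
  have := wj0 s; rewrite le_eqVlt => /predU1P[<-|ws]; first by rewrite !mul0r.
  rewrite ler_pM2l// (_ : b / g * c * L = b * L / g * c); last by ring.
  apply: f_avg_le_final => // phi p0; last by move=> v; apply: hU.
  have nonneg : 0 <= \sum_v PrSel p pistar v (final s phi) * Delta p f v (final s phi).
    by apply: sumr_ge0 => v _; apply: mulr_ge0; [exact: PrSel_ge0|exact: Delta_ge0].
  have [||//|hle] := gamma_bound p f n k (final s phi) _ ps _ _ gfin.
  - by rewrite hk.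
  - have [s0 [bb [ws0 ->]]] := tsub_supp _ _ _ _ _ _ pw r0 ws.
    rewrite -hn; apply: leq_trans (card_le_height _ _ phi ws0).
    by apply: subpolicy_card; [exact: trunc_subpolicy|case: pw => _ _; apply].
  - by apply: le_trans nonneg; rewrite pmulr_rle0.
have [->|l0] := posnP l.
  by rewrite mul0r oppr0 expR0 subrr mul0r; apply: f_avg_ge0.
have b0 : 0 <= b.
  by have [|L []] := gap l 0 1 l0 (leqnn l) (lexx 0) r11; rewrite ?cpi1.
set B := b / g * c.
have B0 : 0 <= B by rewrite mulr_ge0// divr_ge0// ltW.
(* [F - f_avg pi_j] contracts by [B / (B + 1)] from [j] to [j + 1]. *)
suff main j : (j <= l)%N -> forall t r, 0 <= t -> 0 <= r <= 1 ->
    c_avg p (tsub p f pi t r) = j%:R ->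
    F - f_avg p f (tsub p f pi t r) <= expR (- (j%:R / (B + 1))) * F.
  have := main l (leqnn l) 0 1 (lexx 0) r11; rewrite cpi1 fpi1 => /(_ cpi).
  lra.
elim: j => [|j IH] jl t r t0 r0 cj.
  rewrite mul0r oppr0 expR0 mul1r gerBl; apply: f_avg_ge0 => //.
  exact: tsub_policy.
have [L [L0 hL hF _]] := gap _ _ _ (ltn0Sn j) jl t0 r0 cj.
have lt_j : j%:R < c_avg p (tsub p f pi t r) by rewrite cj ltr_nat.
have [t' [r' [dm r0' cj']]] := tsub_below p f _ _ _ _ r0 (ler0n _ j) lt_j.
have t0' : 0 <= t' by case: dm => [/ltW/(le_trans t0)//|[-> _]].
have {}IH := IH (ltnW jl) _ _ t0' r0' cj'.
have := tsub_gain p f pp _ _ _ _ _ _ pw r0 r0' dm hL.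
rewrite cj cj' -natrB// subSnn mulr1.
set Fj := f_avg p f (tsub p f pi t r) in hF *.
set Fj' := f_avg p f (tsub p f pi t' r') in IH * => hLF.
have B1 : 0 < B + 1 by lra.
have hq : B / (B + 1) <= expR (- (B + 1)^-1).
  apply: le_trans (expR_ge1Dx _); rewrite ler_pdivrMr//.
  by rewrite mulrDl mul1r mulNr mulVf ?gt_eqF//; lra.
have hd : F - Fj <= B / (B + 1) * (F - Fj').
  rewrite mulrAC ler_pdivlMr//.
  by have := ler_wpM2l B0 hLF; rewrite -/B in hF; nra.
rewrite -addn1 natrD mulrDl mul1r opprD expRD mulrAC mulrC.
apply: le_trans hd _.
apply: (@le_trans _ _ (B / (B + 1) * (expR (- (j%:R / (B + 1))) * F))).
  by apply: ler_wpM2l => //; rewrite divr_ge0// ltW.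
by apply: ler_wpM2r hq; apply: mulr_ge0 => //; apply: expR_ge0.
Qed.
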